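(* Let $K \subseteq \mathbb{R}^2$ be a $1$-symmetric convex body that is invariant under rotation by $45^\circ$ (about the origin). Then $$ d_{BM}(K,\mathcal{P}^2) = \sqrt{2}. $$
   Context: A convex body in $\mathbb{R}^n$ is a compact convex set with non-empty interior. A convex body $K\subseteq\mathbb{R}^n$ is $1$-symmetric if for every $x=(x_1,\ldots,x_n)\in K$, every choice of signs $\sigma\in\{-1,1\}^n$ and every permutation $\pi$ of $\{1,\ldots,n\}$, one has $(\sigma_1x_{\pi(1)},\ldots,\sigma_nx_{\pi(n)})\in K$. $\mathcal{P}^2=[-1,1]^2$. The Banach-Mazur distance of convex bodies $K,L\subseteq\mathbb{R}^n$ is $d_{BM}(K,L)=\inf\{\rho>0 : K+u\subseteq T(L+v)\subseteq\rho(K+u)\}$, where the infimum is over all invertible linear operators $T:\mathbb{R}^n\to\mathbb{R}^n$ and vectors $u,v\in\mathbb{R}^n$ (it is attained, and for origin symmetric $K,L$ one may take $u=v=0$). *)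

(* Defs.v *)
From HB Require Import structures.
From mathcomp Require Import all_boot all_order all_algebra all_fingroup.
From mathcomp Require Import all_classical all_reals all_analysis.

Set Implicit Arguments.
Unset Strict Implicit.
Unset Printing Implicit Defensive.

Import Order.TTheory GRing.Theory Num.Theory.
Import numFieldNormedType.Exports.

Local Open Scope classical_set_scope.
Local Open Scope ring_scope.

Definition convex_body (R : realType) (n : nat) (K : set 'rV[R]_n) : Prop :=
  [/\ compact K, convex_set K & interior K !=set0].

Definition one_symmetric (R : realType) (n : nat) (K : set 'rV[R]_n) : Prop :=
  forall (x : 'rV[R]_n) (sigma : 'I_n -> R) (p : 'S_n),
    K x -> (forall i, sigma i = -1 \/ sigma i = 1) ->
    K (\row_i (sigma i * x 0 (p i))).

Definition cube (R : realType) (n : nat) : set 'rV[R]_n :=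
  [set x | forall i, -1 <= x 0 i <= 1].

Definition translate (R : realType) (n : nat) (K : set 'rV[R]_n)
  (u : 'rV[R]_n) : set 'rV[R]_n := [set x + u | x in K].

Definition dilate (R : realType) (n : nat) (rho : R) (K : set 'rV[R]_n)
  : set 'rV[R]_n := [set rho *: x | x in K].

Definition banach_mazur_ratios (R : realType) (n : nat) (K L : set 'rV[R]_n)
  : set R :=
  [set rho | 0 < rho /\
    exists (T : {linear 'rV[R]_n -> 'rV[R]_n}) (u v : 'rV[R]_n),
      [/\ bijective T,
          translate K u `<=` T @` translate L v &
          T @` translate L v `<=` dilate rho (translate K u)]].

(* [inf] is 0 on the empty set, but the set of ratios is nonempty (and bounded
   below by 0) whenever K and L are convex bodies. *)
Definition dBM (R : realType) (n : nat) (K L : set 'rV[R]_n) : R :=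
  inf (banach_mazur_ratios K L).

Definition rotation (R : realType) (t : R) (x : 'rV[R]_2) : 'rV[R]_2 :=
  \row_i (if i == 0 then cos t * x 0 0 - sin t * x 0 1
          else sin t * x 0 0 + cos t * x 0 1).

(* Main.v *)
Require Import Defs.
From mathcomp Require Import all_boot all_order all_algebra all_fingroup.
From mathcomp Require Import all_classical all_reals all_analysis.
From mathcomp Require Import ring lra.

Set Implicit Arguments.
Unset Strict Implicit.
Unset Printing Implicit Defensive.

Import Order.TTheory GRing.Theory Num.Theory.
Import numFieldNormedType.Exports.

Local Open Scope classical_set_scope.
Local Open Scope ring_scope.

(** Let K be invariant under the symmetries of the square and under the
rotation by an eighth of a turn, and let P be the square [-1, 1]^2.

Upper bound.  Let h be the largest first coordinate of a point of K.  By
symmetry K lies in the square h P.  Averaging a maximizing point with its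
mirror image puts (h, 0) in K, and an eighth of a turn moves it to
(h, h) / sqrt 2, a corner of (h / sqrt 2) P.  As K contains with a point the
whole box that the point spans ([one_symmetric_solid]), it contains
(h / sqrt 2) P, so that K <= h P <= sqrt 2 K.

Lower bound.  Since K and P are convex and centrally symmetric, the
translations can be averaged away ([centered_inclusions]), which leaves a
parallelogram T P with K <= T P <= rho K.  Let a, b, -a, -b be its vertices
and D = det (a, b).  The vertex a lies in rho K, so the images of a / rho under
the rotations by one and by three eighths of a turn lie in K, hence in T P.
Membership of x in T P says |det (x, b)| + |det (a, x)| <= |D|; for these two
points it reads
    |D - <a, b>| + |a|^2 <= sqrt 2 rho |D|  and
    |D + <a, b>| + |a|^2 <= sqrt 2 rho |D|,
and averaging eliminates the inner product: |D| + |a|^2 <= sqrt 2 rho |D|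
([eighth_turns_bound]).  The same holds for b.  Adding both and using
|a|^2 + |b|^2 >= 2 |D| yields 4 |D| <= 2 sqrt 2 rho |D|, that is,
rho >= sqrt 2. *)

(** * Convexity and symmetry *)

Lemma one_symmetric_opp (R : realType) (n : nat) (K : set 'rV[R]_n)
    (x : 'rV[R]_n) : one_symmetric K -> K x -> K (- x).
Proof.
move=> Ks Kx.
have -> : - x = \row_i (-1 * x 0 ((1 : 'S_n)%g i)).
  by apply/rowP => i; rewrite !mxE perm1 mulN1r.
by apply: (Ks x (fun=> -1)) => // i; left.
Qed.

Lemma convex_set_midpoint (R : realType) (n : nat) (K : set 'rV[R]_n)
    (x y : 'rV[R]_n) : convex_set K -> K x -> K y -> K (2^-1 *: (x + y)).
Proof.
move=> Kc Kx Ky.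
have l0 : 0 <= (2^-1 : R) by lra.
have l1 : (2^-1 : R) <= 1 by lra.
have := Kc x y (Itv01 l0 l1) (mem_set Kx) (mem_set Ky).
rewrite inE; congr (K _); apply/rowP => i; rewrite /conv/= !mxE /unstable.onem/=.
by field.
Qed.

(** The point is a convex combination of x and of its mirror image under the
    sign change of the i-th coordinate. *)
Lemma one_symmetric_shrink_coord (R : realType) (n : nat) (K : set 'rV[R]_n)
    (x : 'rV[R]_n) (i : 'I_n) (t : R) :
  convex_set K -> one_symmetric K -> K x -> `|t| <= `|x 0 i| ->
  K (\row_j (if j == i then t else x 0 j)).
Proof.
move=> Kc Ks Kx tx.
have Kx' : K (\row_j ((if j == i then -1 else 1) * x 0 ((1 : 'S_n)%g j))).
  by apply: (Ks x) => // j; case: ifP => _; [left|right].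
(* The weight l of x solves l (x_i) + (1 - l) (- x_i) = t.  If x_i = 0 then
   t = 0, and the convention t / 0 = 0 still gives a weight in [0, 1]. *)
pose l := (1 + t / x 0 i) / 2.
have lx : t = (2 * l - 1) * x 0 i.
  have [x0|x0] := eqVneq (x 0 i) 0.
    by move: tx; rewrite x0 mulr0 normr0 normr_le0 => /eqP.
  by rewrite /l; field.
have /andP[l0 l1] : 0 <= l <= 1.
  have : `|t / x 0 i| <= 1.
    have [x0|x0] := eqVneq (x 0 i) 0; first by rewrite x0 invr0 mulr0 normr0.
    by rewrite normrM normfV ler_pdivrMr ?normr_gt0// mul1r.
  by rewrite ler_norml /l => ?; lra.
have := Kc x _ (Itv01 l0 l1) (mem_set Kx) (mem_set Kx').
rewrite inE; congr (K _); apply/rowP => j; rewrite /conv/= !mxE perm1 /unstable.onem/=.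
by case: eqP => [->|_]; [rewrite [RHS]lx|]; ring.
Qed.

(** The coordinates can be shrunk one after the other. *)
Lemma one_symmetric_solid (R : realType) (n : nat) (K : set 'rV[R]_n)
    (x y : 'rV[R]_n) :
  convex_set K -> one_symmetric K -> K x ->
  (forall i, `|y 0 i| <= `|x 0 i|) -> K y.
Proof.
move=> Kc Ks Kx yx.
have step (s : seq 'I_n) : K (\row_j (if j \in s then y 0 j else x 0 j)).
  elim: s => [|i s IH].
    by rewrite (_ : \row_j _ = x)//; apply/rowP => j; rewrite !mxE.
  have -> : \row_j (if j \in i :: s then y 0 j else x 0 j) =
      \row_j (if j == i then y 0 i
              else (\row_k (if k \in s then y 0 k else x 0 k)) 0 j).
    by apply/rowP => j; rewrite !mxE inE; case: eqP => [->|].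
  apply: one_symmetric_shrink_coord => //; rewrite mxE.
  by case: ifP => // _; exact: yx.
have := step (enum 'I_n); congr (K _).
by apply/rowP => j; rewrite !mxE mem_enum.
Qed.

(** * The rotation by an eighth of a turn *)

Lemma ord2_cases (i : 'I_2) : i = 0 \/ i = 1.
Proof. by case: i => [[|[|//]] ?]; [left|right]; apply: val_inj. Qed.

Lemma rotation_piquarterE (R : realType) (x : 'rV[R]_2) :
  rotation (pi / 4) x =
  \row_i ((if i == 0 then x 0 0 - x 0 1 else x 0 0 + x 0 1) / Num.sqrt 2).
Proof.
have pi0 := pi_gt0 R.
have c0 : 0 < cos (pi / 4 : R) by apply: cos_gt0_pihalf; lra.
have sc : sin (pi / 4 : R) = cos (pi / 4).
  by have := tan_piquarter R; rewrite /tan => /(canRL (divfK (lt0r_neq0 c0))) ->; rewrite mul1r.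
have cE : cos (pi / 4 : R) = (Num.sqrt 2)^-1.
  have := cos2Dsin2 (pi / 4 : R); rewrite sc => c2.
  rewrite -sqrtrV ?ler0n// -[LHS]gtr0_norm// -sqrtr_sqr; congr Num.sqrt.
  by lra.
apply/rowP => i; rewrite !mxE sc cE; case: ifP => _; ring.
Qed.

Lemma rotation_piquarter3E (R : realType) (x : 'rV[R]_2) :
  rotation (pi / 4) (rotation (pi / 4) (rotation (pi / 4) x)) =
  \row_i ((if i == 0 then - x 0 0 - x 0 1 else x 0 0 - x 0 1) / Num.sqrt 2).
Proof.
have w0 : Num.sqrt (2 : R) != 0 by rewrite gt_eqF// sqrtr_gt0.
have w2 := @sqr_sqrtr R 2 (ler0n _ _).
have h (c : R) : 2 * c / Num.sqrt 2 / Num.sqrt 2 = c.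
  by rewrite -{1}w2; field.
rewrite !rotation_piquarterE; apply/rowP => i; rewrite !mxE/=; congr (_ / _).
by case: ifP => _; rewrite -[RHS]h; field.
Qed.

(** * Removing the translations *)

(** Central symmetry sends an inclusion up to translation to the inclusion with
    the opposite translation; taking midpoints of the two cancels it. *)
Lemma centered_inclusions (R : realType) (n : nat) (K : set 'rV[R]_n)
    (L : set 'rV[R]_n) (rho : R) (T : {linear 'rV[R]_n -> 'rV[R]_n})
    (u v : 'rV[R]_n) :
  convex_set K -> one_symmetric K -> convex_set L -> one_symmetric L ->
  translate K u `<=` T @` translate L v ->
  T @` translate L v `<=` dilate rho (translate K u) ->
  K `<=` T @` L /\ T @` L `<=` dilate rho K.
Proof.
move=> Kc Ks Lc Ls KL LK; split=> [x Kx|_ [p Lp <-]].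
- have /KL[_ [p Lp <-] Tp] : translate K u (x + u) by exists x.
  have /KL[_ [q Lq <-] Tq] : translate K u (- x + u).
    by exists (- x) => //; exact: one_symmetric_opp.
  exists (2^-1 *: (p - q)).
    by apply: convex_set_midpoint => //; exact: one_symmetric_opp.
  have -> : p - q = (p + v) - (q + v) by rewrite opprD addrACA subrr addr0.
  by rewrite linearZ linearB/= Tp Tq; apply/rowP => i; rewrite !mxE; field.
- have /LK[_ [k Kk <-] kE] : (T @` translate L v) (T (p + v)).
    by exists (p + v) => //; exists p.
  have /LK[_ [m Km <-] mE] : (T @` translate L v) (T (- p + v)).
    exists (- p + v) => //; exists (- p) => //; exact: one_symmetric_opp.
  exists (2^-1 *: (k - m)).
    by apply: convex_set_midpoint => //; exact: one_symmetric_opp.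
  have -> : p = 2^-1 *: ((p + v) - (- p + v)).
    by apply/rowP => i; rewrite !mxE; field.
  by rewrite [T _]linearZ [T (_ - _)]linearB/= -kE -mE; apply/rowP => i; rewrite !mxE; field.
Qed.

Lemma cube_convex (R : realType) (n : nat) : convex_set (@cube R n).
Proof.
move=> x y l; rewrite !inE => Px Py i.
have l0 : 0 <= l%:num by [].
have l1 : l%:num <= 1 by [].
have := Px i; have := Py i; rewrite /conv/= !mxE /unstable.onem/=.
by move: (l%:num) l0 l1 => {}l l0 l1 /andP[? ?] /andP[? ?]; apply/andP; split; nra.
Qed.

Lemma cube_one_symmetric (R : realType) (n : nat) : one_symmetric (@cube R n).
Proof.
move=> x s p Px sP i; rewrite mxE; have := Px (p i).
by case: (sP i) => -> ?; lra.
Qed.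

(** * Lower bound *)

Definition det2 (R : realType) (x y : 'rV[R]_2) : R :=
  x 0 0 * y 0 1 - x 0 1 * y 0 0.

Definition sqnorm2 (R : realType) (x : 'rV[R]_2) : R :=
  x 0 0 ^+ 2 + x 0 1 ^+ 2.

(** The image of the square has vertices a, b, -a, -b, so its points are the
    s a + t b with |s| + |t| <= 1; by Cramer's rule s and t are the quotients of
    det (x, b) and det (a, x) by det (a, b).  Clearing the denominator keeps
    the estimate meaningful for a singular T. *)
Lemma cube_image_det2 (R : realType) (T : {linear 'rV[R]_2 -> 'rV[R]_2})
    (a b x : 'rV[R]_2) :
  a = T (\row_i 1) -> b = T (\row_i (if i == 0 then 1 else -1)) ->
  (T @` @cube R 2) x -> `|det2 x b| + `|det2 a x| <= `|det2 a b|.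
Proof.
move=> aE bE [p Pp <-].
(* These are the coordinates of p in the basis (1, 1), (1, -1). *)
pose s := (p 0 0 + p 0 1) / 2; pose t := (p 0 0 - p 0 1) / 2.
have -> : T p = s *: a + t *: b.
  rewrite aE bE -!linearZ -linearD/=; congr (T _); apply/rowP => i.
  have [->|->] := ord2_cases i.
  - by rewrite !mxE /s /t/=; field.
  - by rewrite !mxE /s /t/=; field.
have -> : det2 (s *: a + t *: b) b = s * det2 a b by rewrite /det2 !mxE; ring.
have -> : det2 a (s *: a + t *: b) = t * det2 a b by rewrite /det2 !mxE; ring.
rewrite !(normrM _ (det2 a b)) -mulrDl ler_piMl//.
have := Pp 0; have := Pp 1; rewrite /s /t => /andP[? ?] /andP[? ?].
by case: (ler0P ((p 0 0 + p 0 1) / 2)); case: (ler0P ((p 0 0 - p 0 1) / 2)); lra.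
Qed.

(** The rotations by one and by three eighths of a turn are symmetric about the
    normal direction of a.  Their estimates therefore differ only in the sign
    of the inner product of a and b, and the average is free of it. *)
Lemma eighth_turns_bound (R : realType) (rho : R) (a b k : 'rV[R]_2) :
  0 < rho -> a = rho *: k ->
  (forall x, x = rotation (pi / 4) k \/
             x = rotation (pi / 4) (rotation (pi / 4) (rotation (pi / 4) k)) ->
     `|det2 x b| + `|det2 a x| <= `|det2 a b|) ->
  sqnorm2 a + `|det2 a b| <= Num.sqrt 2 * rho * `|det2 a b|.
Proof.
move=> r0 ak H.
have := H _ (or_introl erefl); have {H} := H _ (or_intror erefl).
have w0 : 0 < Num.sqrt (2 : R) by rewrite sqrtr_gt0.
rewrite rotation_piquarter3E rotation_piquarterE; move: (Num.sqrt 2) w0 => w w0.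
have wn0 : w != 0 by rewrite gt_eqF.
have rn0 : rho != 0 by rewrite gt_eqF.
have kE i : k 0 i = a 0 i / rho by rewrite ak mxE mulrC mulKf.
have wr0 : 0 < w * rho by exact: mulr_gt0.
have scale (z1 z2 y1 y2 D : R) : w * rho * z1 = y1 -> w * rho * z2 = y2 ->
    `|z1| + `|z2| <= D -> `|y1| + `|y2| <= w * rho * D.
  by move=> <- <- h; rewrite !(normrM (w * rho)) gtr0_norm// -mulrDr ler_pM2l.
pose ip := a 0 0 * b 0 0 + a 0 1 * b 0 1.
move=> /(scale _ _ (- (ip + det2 a b)) (sqnorm2 a)) h3.
move=> /(scale _ _ (det2 a b - ip) (sqnorm2 a)) h1.
have {}h3 : `|- (ip + det2 a b)| + `|sqnorm2 a| <= w * rho * `|det2 a b|.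
  by apply: h3; rewrite /ip /det2 /sqnorm2 !mxE /= !kE; field; rewrite wn0.
have {}h1 : `|det2 a b - ip| + `|sqnorm2 a| <= w * rho * `|det2 a b|.
  by apply: h1; rewrite /ip /det2 /sqnorm2 !mxE /= !kE; field; rewrite wn0.
have n0 : 0 <= sqnorm2 a by rewrite addr_ge0 ?sqr_ge0.
rewrite normrN (ger0_norm n0) in h3; rewrite (ger0_norm n0) in h1.
have : `|2 * det2 a b| <= `|det2 a b - ip| + `|ip + det2 a b|.
  by apply: le_trans (ler_normD _ _); rewrite (_ : 2 * _ = det2 a b - ip + (ip + det2 a b))//; ring.
rewrite normrM ger0_norm ?ler0n//; lra.
Qed.

(** Applies the previous estimate to both vertices; injectivity of T serves to
    make the area of the parallelogram nonzero. *)
Lemma parallelogram_ratio_ge (R : realType) (K : set 'rV[R]_2) (rho : R)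
    (T : {linear 'rV[R]_2 -> 'rV[R]_2}) :
  rotation (pi / 4) @` K `<=` K -> 0 < rho -> injective T ->
  K `<=` T @` @cube R 2 -> T @` @cube R 2 `<=` dilate rho K ->
  Num.sqrt 2 <= rho.
Proof.
move=> Krot r0 Tinj KP PK.
pose p : 'rV[R]_2 := \row_i 1.
pose q : 'rV[R]_2 := \row_i (if i == 0 then 1 else -1).
have Pp : cube p by move=> i; rewrite mxE; apply/andP; split; lra.
have Pq : cube q by move=> i; rewrite mxE; apply/andP; case: ifP; split; lra.
have /PK[k Kk kE] : (T @` @cube R 2) (T p) by exists p.
have /PK[m Km mE] : (T @` @cube R 2) (T q) by exists q.
have rotK x : K x -> K (rotation (pi / 4) x) by move=> Kx; apply: Krot; exists x.
have rotP z x : K z -> x = rotation (pi / 4) z \/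
    x = rotation (pi / 4) (rotation (pi / 4) (rotation (pi / 4) z)) ->
    (T @` @cube R 2) x.
  by move=> Kz [] ->; [exact/KP/rotK|exact/KP/rotK/rotK/rotK].
have detC (x y : 'rV[R]_2) : `|det2 x y| = `|det2 y x|.
  by rewrite -normrN /det2; congr `|_|; ring.
have {}kE := esym kE; have {}mE := esym mE.
have Ha : sqnorm2 (T p) + `|det2 (T p) (T q)| <=
    Num.sqrt 2 * rho * `|det2 (T p) (T q)|.
  by apply: eighth_turns_bound kE _ => // x /(rotP _ _ Kk) /cube_image_det2; exact.
have Hb : sqnorm2 (T q) + `|det2 (T p) (T q)| <=
    Num.sqrt 2 * rho * `|det2 (T p) (T q)|.
  rewrite (detC (T p)); apply: eighth_turns_bound mE _ => // x /(rotP _ _ Km) Px.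
  have := cube_image_det2 erefl erefl Px.
  by rewrite (detC x (T q)) (detC (T p) x) (detC (T p) (T q)) addrC.
have sq_ge0 (x : 'rV[R]_2) : 0 <= sqnorm2 x by rewrite addr_ge0 ?sqr_ge0.
have hadamard (x y : 'rV[R]_2) : 2 * `|det2 x y| <= sqnorm2 x + sqnorm2 y.
  have h1 := sqr_ge0 (x 0 0 - y 0 1); have h2 := sqr_ge0 (x 0 1 + y 0 0).
  have h3 := sqr_ge0 (x 0 0 + y 0 1); have h4 := sqr_ge0 (x 0 1 - y 0 0).
  by rewrite /sqnorm2 /det2; case: (ler0P (x 0 0 * y 0 1 - _)) => _; nra.
(* If the determinant vanished, the estimate for T p would force T p = 0. *)
have D0 : 0 < `|det2 (T p) (T q)|.
  rewrite lt_neqAle normr_ge0 andbT; apply/eqP => D0; move: Ha.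
  rewrite -D0 mulr0 addr0 => Tp0.
  have : sqnorm2 (T p) = 0 by apply/eqP; rewrite eq_le Tp0 sq_ge0.
  move/eqP; rewrite paddr_eq0 ?sqr_ge0// !sqrf_eq0 => /andP[/eqP T0 /eqP T1].
  have /Tinj /rowP /(_ 0) : T p = T 0.
    rewrite linear0; apply/rowP => i; rewrite mxE.
    by have [->|->] := ord2_cases i.
  by rewrite !mxE => /eqP; rewrite oner_eq0.
have w0 : 0 < Num.sqrt (2 : R) by rewrite sqrtr_gt0.
have := @sqr_sqrtr R 2 (ler0n _ _) => w2.
have : 2 * `|det2 (T p) (T q)| <= Num.sqrt 2 * rho * `|det2 (T p) (T q)|.
  have := hadamard (T p) (T q); lra.
by rewrite ler_pM2r// -{1}w2 expr2 ler_pM2l.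
Qed.

(** * Upper bound *)

(** Takes for h the maximum of the first coordinate on K: permutations and
    signs make it a bound for all coordinates, and shrinking the second
    coordinate of a maximizer to 0 leaves a point of K.  Positivity of h is
    where the non-empty interior is needed. *)
Lemma one_symmetric_max_coord (R : realType) (K : set 'rV[R]_2) :
  convex_body K -> one_symmetric K ->
  exists h : R, [/\ 0 < h, (forall x i, K x -> `|x 0 i| <= h) &
    K (\row_i (if i == 0 then h else 0))].
Proof.
move=> [Kcpt Kc [c cK]] Ks.
have Kc0 : K c by exact: interior_subset.
have [||x Kx xmax] := @compact_EVT_max _ R (fun x : 'rV[R]_2 => x 0 0) K _ Kcpt.
- by exists c.
- by apply: continuous_subspaceT; exact: coord_continuous.
rewrite inE in Kx.
have coord_le y i : K y -> `|y 0 i| <= x 0 0.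
  move=> Ky.
  have le z : K z -> z 0 i <= x 0 0.
    move=> Kz.
    have : K (\row_j (1 * z 0 ((tperm 0 i : 'S_2) j))).
      by apply: (Ks z (fun=> 1)) => // j; right.
    by move=> /mem_set/xmax; rewrite mxE mul1r tpermL.
  rewrite ler_norml le// andbT.
  by have := le _ (one_symmetric_opp Ks Ky); rewrite mxE; lra.
exists (x 0 0); split => //.
  rewrite lt_neqAle (le_trans _ (coord_le c 0 Kc0))// andbT eq_sym; apply/eqP => x0.
  move: cK; rewrite /interior/= => /nbhs_ballP[e /= e0] ceK.
  (* If h were 0, both c and a nearby point with another first coordinate would
     have first coordinate 0. *)
  pose d : 'rV[R]_2 := \row_i (c 0 i + e / 2).
  have /(coord_le d 0) : K d.
    apply: ceK; split=> // i j; rewrite /ball/= mxE (ord1 i) opprD addNKr normrN.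
    by rewrite gtr0_norm; lra.
  have := coord_le c 0 Kc0; rewrite x0 !normr_le0 mxE => /eqP ->; rewrite add0r.
  by move=> /eqP; lra.
apply: (one_symmetric_solid Kc Ks Kx) => i; rewrite mxE.
by case: eqP => [->//|_]; rewrite normr0.
Qed.

(** The witness is the homothety of ratio h, without translations. *)
Lemma sqrt2_banach_mazur_ratio (R : realType) (K : set 'rV[R]_2) :
  convex_body K -> one_symmetric K -> rotation (pi / 4) @` K `<=` K ->
  banach_mazur_ratios K (@cube R 2) (Num.sqrt 2).
Proof.
move=> Kb Ks Krot; have [h [h0 Kh Khe]] := one_symmetric_max_coord Kb Ks.
have [_ Kc _] := Kb.
have w0 : 0 < Num.sqrt (2 : R) by rewrite sqrtr_gt0.
have hn0 : h != 0 by rewrite gt_eqF.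
have corner : K (\row_i (h / Num.sqrt 2)).
  have : K (rotation (pi / 4) (\row_i (if i == 0 then h else 0))).
    by apply: Krot; eexists; [exact: Khe|].
  rewrite rotation_piquarterE; congr (K _); apply/rowP => i; rewrite !mxE/=.
  by rewrite subr0 addr0 if_same.
split=> //; exists ( *:%R h : {linear 'rV[R]_2 -> 'rV[R]_2}), 0, 0; split.
- by exists (fun x : 'rV[R]_2 => h^-1 *: x) => x; rewrite /= scalerA ?mulVf ?mulfV// scale1r.
- move=> _ [x Kx <-]; exists (h^-1 *: x + 0).
    exists (h^-1 *: x) => // i; rewrite mxE -ler_norml normrM normfV (gtr0_norm h0).
    by rewrite mulrC ler_pdivrMr// mul1r Kh.
  by rewrite /= !addr0 scalerA mulfV// scale1r.
- move=> _ [_ [p Pp <-] <-]; rewrite addr0.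
  exists ((Num.sqrt 2)^-1 *: (h *: p)); last first.
    by rewrite scalerA mulfV ?scale1r// gt_eqF.
  exists ((Num.sqrt 2)^-1 *: (h *: p)); last by rewrite addr0.
  apply: (one_symmetric_solid Kc Ks corner) => i; rewrite !mxE mulrA (mulrC _ h).
  by rewrite normrM ler_piMr// ler_norml.
Qed.

Theorem corollary4p5 (R : realType) (K : set 'rV[R]_2)
  (hK : convex_body K) (hsym : one_symmetric K)
  (hrot : rotation (pi / 4) @` K = K) :
  dBM K (@cube R 2) = Num.sqrt 2.
Proof.
have Krot : rotation (pi / 4) @` K `<=` K by rewrite hrot.
have ratio2 := sqrt2_banach_mazur_ratio hK hsym Krot.
have [_ Kc _] := hK.
apply/le_anti/andP; split.
  by apply: ge_inf => //; exists 0 => rho [/ltW].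
apply: lb_le_inf; first by exists (Num.sqrt 2).
move=> rho [rho0 [T [u [v [Tbij KP PK]]]]].
have [KP' PK'] := centered_inclusions Kc hsym (@cube_convex R 2)
  (@cube_one_symmetric R 2) KP PK.
exact: parallelogram_ratio_ge Krot rho0 (bij_inj Tbij) KP' PK'.
Qed.
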